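(* For all integers $m\geq 0$ and $n\geq 1$, \[ q(m,n)\geq p(-m+1,n). \]
   Context: For a partition $\lambda$, $\operatorname{rank}(\lambda)$ is its largest part minus its number of parts. $p(m,n)$ is the number of partitions of $n$ with rank at least $m$. For a partition $\lambda=(\lambda_1\geq\cdots\geq\lambda_\ell)$, its rank-set is the infinite sequence $[-\lambda_1,1-\lambda_2,\ldots,j-\lambda_{j+1},\ldots,\ell-1-\lambda_\ell,\ell,\ell+1,\ldots]$. Then $q(m,n)$ is the number of partitions of $n$ whose rank-set contains $m$. *)

(* Defs.v *)
From mathcomp Require Import all_boot all_order all_algebra.
Set Implicit Arguments. Unset Strict Implicit. Unset Printing Implicit Defensive.
Import GRing.Theory Num.Theory.

Definition is_partition (n : nat) (s : seq nat) : bool :=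
  [&& sorted geq s, all (fun x => 0 < x) s & sumn s == n].

Fixpoint lists (k b : nat) : seq (seq nat) :=
  if k is k'.+1 then [seq x :: t | x <- iota 0 b.+1, t <- lists k' b]
  else [:: [::]].

(* the (duplicate-free) list of all partitions of n: every partition of n
   has at most n parts, each at most n *)
Definition partitions (n : nat) : seq (seq nat) :=
  undup [seq s <- flatten [seq lists k n | k <- iota 0 n.+1] | is_partition n s].

Definition prank (s : seq nat) : int := (head 0%N s)%:Z - (size s)%:Z.

Definition p (m : int) (n : nat) : nat :=
  count (fun s => (m <= prank s)%R) (partitions n).

(* m belongs to the rank-set
   [-l_1, 1 - l_2, ..., (l-1) - l_l, l, l+1, ...] of s (l = size s);
   entry j (0-based, j < l) is j - l_{j+1} = j - nth 0 s j. *)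
Definition in_rank_set (m : int) (s : seq nat) : bool :=
  has (fun j => (j%:Z - (nth 0%N s j)%:Z == m)%R) (iota 0 (size s))
  || ((size s)%:Z <= m)%R.

Definition q (m : int) (n : nat) : nat :=
  count (in_rank_set m) (partitions n).

(* Main.v *)
Require Import Defs.
From mathcomp Require Import all_boot all_order all_algebra.
From mathcomp Require Import zify.
Import GRing.Theory Num.Theory.

(** Let [A m n] count the partitions of [n] whose rank-set misses [m], and
[B m n] those with at least [m] more parts than their largest part; passing to
complements, the claim is [A m n <= B m n]. Writing [P k] for the number of
partitions of [k] and [k = n - m - 1], one has
[A m n + A (m+1) k = P k] and [B m n + B (m+3) k = P k].
Applying each identity twice, with [l = k - m - 2] and [E j = B j - B (j+1)],
[B m n - A m n = (E (m+1) k + E (m+2) k) - (E (m+2) l + E (m+3) l)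
  + (B (m+2) l - A (m+2) l)].
The last difference is nonnegative by induction on [n]; the first one is, since
adding [u] cells to the first row and [v] parts equal to 1, with [u + v = m + 2]
and [u - v] equal to 0, 1 or 2, injects partitions of [l] into those of [k]. *)

(** * Comparing counts of partitions through injective relations *)

(** Induction removes from [t] a partner of the head of [s]; injectivity keeps the partners of the
    other elements available. A relation replaces a map so that images can be given by properties
    only. *)
Lemma leq_size_rel (T U : eqType) (R : T -> U -> Prop) (s : seq T) (t : seq U) :
  uniq s ->
  {in s, forall x, exists2 y, y \in t & R x y} ->
  {in s &, forall x x', forall y, R x y -> R x' y -> x = x'} ->
  size s <= size t.
Proof.
elim: s t => [|x s IHs] t //= /andP[xNs uniq_s] Rex Rinj.
have [y yt Rxy] := Rex x (mem_head x s).
have -> : size t = (size (rem y t)).+1 by rewrite size_rem // prednK //; case: (t) yt.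
rewrite ltnS; apply: IHs => // [x' x's|x' x'' x's x''s z]; last first.
  by apply: Rinj; rewrite inE ?x's ?x''s orbT.
have x'xs : x' \in x :: s by rewrite inE x's orbT.
have [y' y't Rx'y'] := Rex x' x'xs; exists y' => //.
apply: contraNT xNs => y'Nrem; suff <- : x' = x by [].
apply: (Rinj _ _ x'xs (mem_head x s) y') => //; suff -> : y' = y by [].
apply/eqP; apply: contraNT y'Nrem => y'Ny.
by have := perm_mem (perm_to_rem yt) y'; rewrite y't inE (negPf y'Ny).
Qed.

Lemma mem_lists (k b : nat) (s : seq nat) :
  (s \in lists k b) = (size s == k) && all (leq^~ b) s.
Proof.
have listsS k' : lists k'.+1 b = [seq x :: t | x <- iota 0 b.+1, t <- lists k' b] by [].
elim: k s => [|k IHk] [|x s] //; rewrite listsS.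
  by apply/negbTE/negP => /allpairsPdep[y [t [_ _]]].
apply/allpairsPdep/idP => [[y [t [yb tl [-> ->]]]]|].
  by move: tl yb; rewrite IHk mem_iota ltnS /= => /andP[/eqP -> ->] ->; rewrite eqxx.
case/and3P=> sk xb sb; exists x, s; split=> //; first by rewrite mem_iota ltnS.
by rewrite IHk -eqSS sk.
Qed.

Lemma size_partition {n s} : is_partition n s -> size s <= n.
Proof.
case/and3P=> _ + /eqP <-.
by elim: s => //= x s IHs /andP[x0 /IHs]; lia.
Qed.

Lemma mem_partitions (n : nat) (s : seq nat) :
  (s \in partitions n) = is_partition n s.
Proof.
rewrite mem_undup mem_filter; case: (boolP (is_partition n s)) => // ps.
rewrite andTb; apply/flattenP; exists (lists (size s) n).
  by apply: (map_f (lists^~ n)); rewrite mem_iota ltnS (size_partition ps).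
rewrite mem_lists eqxx /=; case/and3P: ps => _ _ /eqP <-.
elim: (s) => //= x t IHt; rewrite leq_addr /=.
by apply: sub_all IHt => y; lia.
Qed.

Lemma leq_count_partitions (R : seq nat -> seq nat -> Prop)
    (a b : pred (seq nat)) (n k : nat) :
  (forall s, is_partition n s -> a s ->
     exists2 t, is_partition k t & b t /\ R s t) ->
  (forall s s' t, is_partition n s -> is_partition n s' -> is_partition k t ->
     R s t -> R s' t -> s = s') ->
  count a (partitions n) <= count b (partitions k).
Proof.
move=> Rex Rinj; rewrite -!size_filter.
apply: (@leq_size_rel _ _ (fun s t => is_partition k t /\ R s t)).
- by rewrite filter_uniq // undup_uniq.
- move=> s; rewrite mem_filter mem_partitions => /andP[sa ps].
  have [t pt [tb Rst]] := Rex s ps sa.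
  by exists t; rewrite // mem_filter tb mem_partitions.
move=> s s'; rewrite !mem_filter !mem_partitions => /andP[_ ps] /andP[_ ps'].
by move=> t [pt Rst] [_ Rs't]; apply: (Rinj s s' t).
Qed.

(** * Partitions as zero-padded decreasing sequences *)

Lemma nth_partition_leq n s i j :
  is_partition n s -> i <= j -> nth 0 s j <= nth 0 s i.
Proof.
case/and3P=> srt _ _ ij; have [js|sj] := ltnP j (size s); last by rewrite nth_default.
apply: (sorted_leq_nth _ _ 0 srt) => //.
- by move=> x y z; rewrite /geq /=; lia.
- exact: leqnn.
- by rewrite inE; lia.
Qed.

Lemma nth_partition_eq0 n s j :
  is_partition n s -> (nth 0 s j == 0) = (size s <= j).
Proof.
case/and3P=> _ pos _; apply/eqP/idP; last exact: nth_default.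
by apply: contra_eqT; rewrite -ltnNge => /(all_nthP 0 pos); lia.
Qed.

(** Parts are positive, so the length is the first index where the padded sequence vanishes. *)
Lemma eq_partition n n' s t :
  is_partition n s -> is_partition n' t -> nth 0 s =1 nth 0 t -> s = t.
Proof.
move=> ps pt st; apply: (@eq_from_nth _ 0) => [|i _]; last exact: st.
have sz j : (size s <= j) = (size t <= j).
  by rewrite -(nth_partition_eq0 _ _ _ ps) -(nth_partition_eq0 _ _ _ pt) st.
by apply/eqP; rewrite eqn_leq sz leqnn -sz leqnn.
Qed.

Lemma sumn_nth (s : seq nat) (N : nat) :
  size s <= N -> sumn s = \sum_(i < N) nth 0 s i.
Proof.
elim: s N => [|x s IHs] [|N] //= sN; first by rewrite big_ord0.
  by rewrite big1 // => i _; rewrite nth_nil.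
by rewrite big_ord_recl /= (IHs N).
Qed.

(** Used to build images from formulas for their parts. As [g] decreases and vanishes at [N], its
    trailing zeros are just padding. *)
Lemma partition_of_fun (N : nat) (g : nat -> nat) :
  (forall i, g i.+1 <= g i) -> g N = 0 ->
  exists2 s, is_partition (\sum_(i < N) g i) s & nth 0 s =1 g.
Proof.
elim: N g => [|N IHN] g gS gN.
  exists [::] => [|i]; first by rewrite big_ord0.
  by rewrite nth_nil; elim: i => // i IHi; have := gS i; lia.
have [s ps sg] := IHN (g \o succn) (fun i => gS i.+1) gN.
have [g0|g0] := posnP (g 0).
  have g00 i : g i = 0 by elim: i => // i IHi; have := gS i; lia.
  exists [::] => [|i]; last by rewrite nth_nil.
  by rewrite big1.
exists (g 0 :: s); last by case=> [|i] //; apply: sg.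
case/and3P: ps => srt pos /eqP sms.
rewrite big_ord_recl /is_partition /= g0 pos sms eqxx andbT /= andbT.
by case: (s) sg srt => //= x t /(_ 0) /= -> ->; rewrite /= gS.
Qed.

(** * Recurrences for rank-sets and for ranks *)

(** The default 0 of [nth] makes the entry at an index [j] past the parts equal to [j], so one
    equation also covers the infinite tail. *)
Lemma in_rank_setP n s (m : nat) : is_partition n s ->
  reflect (exists j, j = m + nth 0 s j) (in_rank_set m%:Z s).
Proof.
move=> ps; apply: (iffP orP) => [[/hasP[j _ jm]|sm]|[j jm]].
- by exists j; lia.
- by exists m; rewrite nth_default; lia.
have [js|sj] := ltnP j (size s).
  by left; apply/hasP; exists j; [rewrite mem_iota | lia].
by right; move: jm; rewrite nth_default; lia.
Qed.

(* If [f] and [g] list the parts of two partitions, this says that the rank-set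
   of [g] is the rank-set of [f] with [m] inserted, shifted by 1. *)
Definition deletion_rel (m : nat) (f g : nat -> nat) : Prop :=
  exists k, [/\ forall j, j < k -> f j = (g j).+1, g k + m.+1 = k
               & forall j, k <= j -> g j.+1 = f j].

(** The first [k] parts lose one cell each, [k] in all, and a part [k - m.+1] is inserted: the net
    loss is [m.+1]. *)
Lemma sum_deletion_rel m f g k N :
    (forall j, j < k -> f j = (g j).+1) -> g k + m.+1 = k ->
    (forall j, k <= j -> g j.+1 = f j) ->
  k <= N -> \sum_(j < N.+1) g j + m.+1 = \sum_(j < N) f j.
Proof.
move=> lek eqk gek /subnKC <-; elim: (N - k) => [|i IHi]; last first.
  by rewrite (addnS k) [RHS]big_ord_recr big_ord_recr /= -IHi gek ?leq_addr // addnAC.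
rewrite addn0 big_ord_recr /= -addnA eqk.
rewrite [RHS](eq_bigr (fun j : 'I_k => g j + 1)) => [|j _]; last by rewrite lek // addn1.
by rewrite big_split /= sum1_card card_ord.
Qed.

(** Rank-sets increase strictly, so a missing [m] has a unique place. Inserting it there and
    shifting by 1 gives a rank-set containing [m.+1]; deleting that entry undoes this. *)
Lemma count_notin_rank_set (m n : nat) :
  count (fun s => ~~ in_rank_set m%:Z s) (partitions (n + m.+1))
  = count (in_rank_set m.+1%:Z) (partitions n).
Proof.
apply/eqP; rewrite eqn_leq; apply/andP; split.
- apply: (@leq_count_partitions (fun s t => deletion_rel m (nth 0 s) (nth 0 t))).
    move=> s ps /(in_rank_setP _ _ _ ps) sNm.
    have exk : exists k, m + nth 0 s k <= k.
      exists (n + m.+1 + m); have /eqP-> : nth 0 s (n + m.+1 + m) == 0; last by lia.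
      by rewrite (nth_partition_eq0 _ _ _ ps) (leq_trans (size_partition ps)) ?leq_addr.
    (* The insertion place is the first index whose rank-set entry reaches [m]. *)
    have [k lek mink] := ex_minnP exk.
    have {}lek : m + nth 0 s k < k.
      by rewrite ltn_neqAle lek andbT; apply/eqP => kE; apply: sNm; exists k.
    have gtk j : j < k -> j < m + nth 0 s j.
      by move=> jk; rewrite ltnNge; apply/negP => /mink; lia.
    have s_gt0 j : j < k -> 0 < nth 0 s j.
      move=> jk; have := nth_partition_leq _ _ j k.-1 ps.
      by have := gtk k.-1; lia.
    (* The inserted part makes entry [k] of the new rank-set equal to [m.+1]. *)
    pose g j := if j < k then (nth 0 s j).-1
                else if j == k then k - m.+1 else nth 0 s j.-1.
    have g1 j : j < k -> nth 0 s j = (g j).+1.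
      by move=> jk; rewrite /g jk prednK // s_gt0.
    have g2 : g k + m.+1 = k by rewrite /g ltnn eqxx; lia.
    have g3 j : k <= j -> g j.+1 = nth 0 s j.
      by move=> kj; rewrite /g; case: ltnP => [|_]; [lia|]; case: eqP => //; lia.
    have sN : nth 0 s (n + m.+1 + k) = 0.
      by apply/eqP; rewrite (nth_partition_eq0 _ _ _ ps) (leq_trans (size_partition ps)) ?leq_addr.
    have [||t pt tg] := @partition_of_fun (n + m.+1 + k).+1 g.
    + move=> j; have sj := nth_partition_leq _ _ _ _ ps (leqnSn j).
      have sj' := nth_partition_leq _ _ _ _ ps (leq_pred j).
      have [jk|jk|jk] := ltngtP j.+1 k.
      * by have := g1 _ jk; have := g1 j; lia.
      * rewrite g3 //; have [->|jNk] := eqVneq j k; first by lia.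
        have j0 : 0 < j by lia.
        by have := g3 j.-1; rewrite prednK // => ->; lia.
      * by have := g1 j; have := gtk j; rewrite jk; lia.
    + by rewrite g3 ?leq_addl.
    exists t.
      have := sum_deletion_rel m _ g k (n + m.+1 + k) g1 g2 g3 (leq_addl _ _).
      rewrite -sumn_nth ?(leq_trans (size_partition ps)) ?leq_addr //.
      by case/and3P: ps => _ _ /eqP -> /addIn <-.
    split; first by apply/(in_rank_setP _ _ _ pt); exists k; rewrite tg; lia.
    by exists k; split=> [j|| j]; rewrite !tg //; [apply: g1 | apply: g3].
  move=> s s' t ps ps' pt [k [l1 e1 r1]] [k' [l2 e2 r2]].
  (* The value [m.+1] occurs only once in the rank-set of [t], which determines [k]. *)
  have kk' : k = k'.
    by have := nth_partition_leq _ _ k k' pt; have := nth_partition_leq _ _ k' k pt; lia.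
  apply: (eq_partition _ _ _ _ ps ps') => j; have [jk|kj] := ltnP j k.
    by rewrite l1 ?l2 -?kk'.
  by rewrite -r1 -?r2 -?kk'.
apply: (@leq_count_partitions (fun t s => deletion_rel m (nth 0 s) (nth 0 t))).
  move=> t pt /(in_rank_setP _ _ _ pt)[k kE].
  pose g j := if j < k then (nth 0 t j).+1 else nth 0 t j.+1.
  have g1 j : j < k -> g j = (nth 0 t j).+1 by rewrite /g => ->.
  have g2 : nth 0 t k + m.+1 = k by lia.
  have g3 j : k <= j -> nth 0 t j.+1 = g j by rewrite /g ltnNge => ->.
  have [||s ps sg] := @partition_of_fun (n + k) g.
  - move=> j; have := nth_partition_leq _ _ _ _ pt (leqnSn j).
    have := nth_partition_leq _ _ _ _ pt (leqnSn j.+1).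
    by rewrite /g; case: ifP; case: ifP; lia.
  - rewrite -g3 ?leq_addl //; apply/eqP; rewrite (nth_partition_eq0 _ _ _ pt).
    by rewrite (leq_trans (size_partition pt)) // -addnS leq_addr.
  exists s.
    rewrite -(sum_deletion_rel m g _ k _ g1 g2 g3) ?leq_addl // in ps.
    rewrite -sumn_nth in ps; first by case/and3P: pt ps => _ _ /eqP ->.
    by rewrite (leq_trans (size_partition pt)) // -addnS leq_addr.
  split; last by exists k; split=> // j; rewrite sg; [apply: g1 | apply: g3].
  apply/(in_rank_setP _ _ _ ps) => -[j]; rewrite sg /g.
  have [jk|kj] := ltnP j k.
    by have := nth_partition_leq _ _ j k pt; lia.
  by have := nth_partition_leq _ _ k j.+1 pt; lia.
move=> t t' s pt pt' ps [k [l1 e1 r1]] [k' [l2 e2 r2]].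
have kk' : k = k'.
  (* If [k < k'], entry [k] of the rank-set of [s] would be above [m] by the first relation and
     below [m] by the second. *)
  have [kk'|kk'|//] := ltngtP k k'.
    have := l2 _ kk'; have := r1 k (leqnn k).
    have := nth_partition_leq _ _ _ _ pt (leqnSn k).
    have := nth_partition_leq _ _ k k' pt'; lia.
  have := l1 _ kk'; have := r2 k' (leqnn k').
  have := nth_partition_leq _ _ _ _ pt' (leqnSn k').
  have := nth_partition_leq _ _ k' k pt; lia.
apply: (eq_partition _ _ _ _ pt pt') => j; have [jk|kj|->] := ltngtP j k.
- by apply/eq_add_S; rewrite -l1 ?l2 -?kk'.
- by case: j kj => // j kj; rewrite r1 ?r2 -?kk'.
- by move: e2; rewrite -kk'; lia.
Qed.

(* Dyson's adjoint map: delete the first column, of length [size s], and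
   insert a first row of length [size s - m.+1]. *)
Lemma count_corank_ge (m n : nat) :
  count (fun s => nth 0 s 0 + m <= size s) (partitions (n + m.+1))
  = count (fun s => size s <= nth 0 s 0 + m.+2) (partitions n).
Proof.
pose R s t := (forall j, nth 0 t j.+1 = (nth 0 s j).-1) /\ size s = nth 0 t 0 + m.+1.
apply/eqP; rewrite eqn_leq; apply/andP; split.
- apply: (@leq_count_partitions R).
    move=> s ps ms.
    (* A positive first part gives [m.+1 <= size s], so the truncated subtraction in [g] is
       exact. *)
    have s0 : 0 < nth 0 s 0.
      rewrite lt0n (nth_partition_eq0 _ _ _ ps) leqn0 size_eq0.
      by apply: contraTN ps => /eqP->; rewrite /is_partition /= addnS.
    pose g j := if j is j'.+1 then (nth 0 s j').-1 else size s - m.+1.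
    have [||t pt tg] := @partition_of_fun (size s).+1 g.
    + case=> [|j] /=; first by lia.
      by have := nth_partition_leq _ _ _ _ ps (leqnSn j); lia.
    + by rewrite /= nth_default.
    have sz : \sum_(j < size s) g j.+1 + size s = n + m.+1.
      case/and3P: (ps) => _ _ /eqP <-; rewrite (sumn_nth _ _ (leqnn _)).
      rewrite [RHS](eq_bigr (fun j : 'I_(size s) => g j.+1 + 1)) => [|j _].
        by rewrite big_split /= sum1_card card_ord.
      by rewrite addn1 prednK // lt0n (nth_partition_eq0 _ _ _ ps) -ltnNge.
    exists t.
      suff <- : \sum_(j < (size s).+1) g j = n by [].
      rewrite big_ord_recl (_ : g (@ord0 (size s)) = size s - m.+1) //.
      by move: sz; rewrite -/(\sum_(j < size s) g j.+1); move: (\sum_(j < size s) _) => S; lia.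
    split; last by split=> [j|]; rewrite tg //=; lia.
    rewrite -(nth_partition_eq0 _ _ _ pt) addnS !tg /= nth_default //; lia.
  move=> s s' t ps ps' pt [ts zs] [ts' zs'].
  apply: (eq_partition _ _ _ _ ps ps') => j.
  (* Equal lengths tell a part 1 from padding, which have the same predecessor. *)
  have := nth_partition_eq0 _ _ j ps; have := nth_partition_eq0 _ _ j ps'.
  by have := ts j; have := ts' j; lia.
apply: (@leq_count_partitions (fun t s => R s t)).
  move=> t pt mt; pose c := nth 0 t 0 + m.+1.
  (* The boolean restores a first column of height [c]; by [mt], at most [c] rows of [t] lie below
     its first. *)
  pose g j := nth 0 t j.+1 + (j < c).
  have szt : size t <= c.+1 by rewrite /c -addnS.
  have [||s ps sg] := @partition_of_fun c g.
  - by move=> j; have := nth_partition_leq _ _ _ _ pt (leqnSn j.+1); rewrite /g; lia.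
  - by rewrite /g nth_default ?ltnn.
  have szs : size s = c.
    have gE j : (size s <= j) = (c <= j).
      rewrite -(nth_partition_eq0 _ _ _ ps) sg /g; have [jc|cj] := ltnP j c.
        by rewrite addn1.
      by rewrite nth_default // (leq_trans szt).
    by have := gE c; have := gE (size s); rewrite !leqnn; lia.
  exists s.
    suff -> : n + m.+1 = \sum_(j < c) g j by [].
    rewrite big_split /= [X in _ = _ + X](eq_bigr (fun=> 1)) => [|j _]; last by rewrite ltn_ord.
    rewrite sum1_card card_ord; case/and3P: (pt) => _ _ /eqP <-.
    by rewrite (sumn_nth _ _ szt) big_ord_recl /= addnAC addnC.
  split; first by have := nth_partition_leq _ _ _ _ pt (leqnSn 0); rewrite szs sg /g /c; lia.
  split=> // j; rewrite sg /g; have [jc|cj] := ltnP j c; first by rewrite addn1.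
  by rewrite nth_default // (leq_trans szt).
move=> t t' s pt pt' ps [ts zs] [ts' zs'].
by apply: (eq_partition _ _ _ _ pt pt') => -[|j]; [lia | rewrite ts ts'].
Qed.

(** * Adding cells, and the induction *)

(** The excess of the length over the first part changes by [v - u], from [a] to [b]. Positivity of
    [a] rules out the empty partition, which has no first row to extend. *)
Lemma leq_count_rank (a b u v n : nat) : 0 < a -> b + u = a + v ->
  count (fun s => size s == nth 0 s 0 + a) (partitions n)
  <= count (fun s => size s == nth 0 s 0 + b) (partitions (n + (u + v))).
Proof.
move=> a0 ab.
apply: (@leq_count_partitions (fun s t =>
  s <> [::] /\ t = nth 0 s 0 + u :: behead s ++ nseq v 1)).
  case=> [|x s] ps /= /eqP sa; first by lia.
  exists (x + u :: s ++ nseq v 1); last first.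
    by split; [rewrite /= size_cat size_nseq; lia | split].
  case/and3P: ps => /= srt /andP[x0 pos] /eqP sms.
  rewrite /is_partition /= all_cat pos all_nseq orbT addn_gt0 x0 /=.
  rewrite sumn_cat sumn_nseq mul1n cat_path; apply/andP; split; last by lia.
  apply/andP; split.
    by case: (s) srt => //= y s' /andP[+ ->]; rewrite /geq /=; lia.
  have : 0 < last (x + u) s.
    case: (s) pos => [|y s'] pos; first by rewrite /=; lia.
    exact: (allP pos _ (mem_last _ _)).
  by elim: v {ab} (last _ _) => //= v IHv y; rewrite {1}/geq /= => ->; rewrite IHv.
move=> [|x s] [|x' s'] t _ _ _ [] // _ -> [] // _ [] /addIn -> E.
have szE : size s = size s'.
  by have := congr1 size E; rewrite !size_cat => /addIn.
by congr (_ :: _); move/eqP: E; rewrite eqseq_cat // => /andP[/eqP].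
Qed.

Lemma leq_count_consecutive_ranks (m n : nat) :
  count (fun s => size s == nth 0 s 0 + m.+2) (partitions n)
    + count (fun s => size s == nth 0 s 0 + m.+3) (partitions n)
  <= count (fun s => size s == nth 0 s 0 + m.+1) (partitions (n + m.+2))
    + count (fun s => size s == nth 0 s 0 + m.+2) (partitions (n + m.+2)).
Proof.
have leE a b u v : 0 < a -> b + u = a + v -> u + v = m.+2 ->
    count (fun s => size s == nth 0 s 0 + a) (partitions n)
    <= count (fun s => size s == nth 0 s 0 + b) (partitions (n + m.+2)).
  by move=> a0 ab <-; apply: leq_count_rank.
(* The total [m.+2] fixes the parity of [u - v]: for odd [m] both excesses drop by 1; for even [m]
   one is kept and the other drops by 2, hence the swap. *)
have := odd_double_half m; case: (odd m) => mE.
  by apply: leq_add; apply: (leE _ _ m./2.+2 m./2.+1); lia.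
rewrite [leqRHS]addnC; apply: leq_add.
  by apply: (leE _ _ m./2.+1 m./2.+1); lia.
by apply: (leE _ _ m./2.+2 m./2); lia.
Qed.

Lemma leq_count_notin_rank_set (m n : nat) :
  count (fun s => ~~ in_rank_set m%:Z s) (partitions n)
  <= count (fun s => nth 0 s 0 + m <= size s) (partitions n).
Proof.
pose A m n := count (fun s => ~~ in_rank_set m%:Z s) (partitions n).
pose B m n := count (fun s => nth 0 s 0 + m <= size s) (partitions n).
pose E m n := count (fun s => size s == nth 0 s 0 + m) (partitions n).
rewrite -/(A m n) -/(B m n).
have A0 j k : k <= j -> A j k = 0.
  move=> kj; apply/eqP; rewrite -leqn0 leqNgt -has_count; apply/hasPn => s.
  rewrite mem_partitions negbK => ps; apply/(in_rank_setP _ _ _ ps); exists j.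
  by rewrite nth_default ?addn0 // (leq_trans (size_partition ps)).
have AE j k : A j (k + j.+1) + A j.+1 k = size (partitions k).
  by rewrite /A count_notin_rank_set count_predC.
have BE j k : B j (k + j.+1) + B j.+3 k = size (partitions k).
  rewrite /B count_corank_ge -(count_predC (fun s => size s <= nth 0 s 0 + j.+2)).
  by congr (_ + _); apply: eq_count => s /=; rewrite -ltnNge -addnS.
have BS j k : B j k = E j k + B j.+1 k.
  rewrite /B /E -count_predUI [X in _ + X](_ : _ = 0); last first.
    by apply/eqP; rewrite -leqn0 leqNgt -has_count; apply/hasPn => s _ /=; lia.
  by rewrite addn0; apply: eq_count => s /=; lia.
elim/ltn_ind: n m => n IHn m.
have [nm|mn] := leqP n m; first by rewrite A0.
have [k nE] : {k | n = k + m.+1} by exists (n - m.+1); rewrite subnK.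
(* For such [k], both [A m.+1 k] and [B m.+3 k] vanish, so [A m n] and [B m n] both count all
   partitions of [k]. *)
have [km|mk] := leqP k m.+1.
  have := AE m k; have := BE m k; rewrite -nE (A0 _ _ km).
  suff -> : B m.+3 k = 0 by lia.
  apply/eqP; rewrite -leqn0 leqNgt -has_count; apply/hasPn => s.
  by rewrite mem_partitions => /size_partition; lia.
have [l kE] : {l | k = l + m.+2} by exists (k - m.+2); rewrite subnK.
have := leq_count_consecutive_ranks m l; rewrite -kE -!/(E _ _).
have := IHn l _ m.+2; have := AE m k; have := BE m k.
have := AE m.+1 l; have := BE m.+1 l; rewrite -nE -kE.
(* These telescope [B] over two steps at [k] and at [l], producing the sums of two [E] terms. *)
have := BS m.+1 k; have := BS m.+2 k; have := BS m.+2 l; have := BS m.+3 l.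
lia.
Qed.

Theorem theorem2p2 (m : int) (n : nat) :
  (0 <= m)%R -> (1 <= n)%N -> (p (- m + 1)%R n <= q m n)%N.
Proof.
case: m => // m _ _; rewrite /p /q.
rewrite -(leq_add2r (count (predC (in_rank_set m)) (partitions n))) count_predC.
rewrite -(count_predC (fun s => (- m%:Z + 1 <= prank s)%R)) leq_add2l.
apply: (leq_trans (leq_count_notin_rank_set m n)).
(* Rank below [-m + 1] means at least [m] more parts than the largest part. *)
by apply: sub_count => s /=; rewrite /prank -nth0; lia.
Qed.
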